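(* Let $K$ be a field, $A=K[x_1,\ldots,x_n]$ and $B=K[y_1,\ldots,y_m]$ polynomial rings in disjoint sets of variables, and $S=A\otimes_K B=K[x_1,\ldots,x_n,y_1,\ldots,y_m]$. Let $I\subset A$ and $J\subset B$ be monomial ideals, let $\{I_i\}_{i\ge 0}$ be a graded $I$-filtration of $A$ and $\{J_j\}_{j\ge 0}$ a graded $J$-filtration of $B$, both satisfying the following two properties (stated for a filtration $\{L_k\}_{k\ge 0}$ of a polynomial ring $R$): (a) each $L_k$ is a monomial ideal; (b) for every $k\ge 1$, if $\mathfrak{p}\in\mathrm{Ass}(L_k)$ and $f\in R$ is a monomial such that $L_k:f=\mathfrak{p}$, then $f\in L_{k-1}$. Let $k\ge 1$ and let $(I+J)_k$ be the ideal of $S$ given by $(I+J)_k=\sum_{i+j=k}I_iJ_j$. If $\mathfrak{p}\subset A$ and $\mathfrak{q}\subset B$ are monomial prime ideals such that $\mathfrak{p}+\mathfrak{q}\in\mathrm{Ass}((I+J)_k)$, then $$\mathrm{v}_{\mathfrak{p}+\mathfrak{q}}((I+J)_k)=\min_{\substack{0\le d<k\\ \mathfrak{p}\in\mathrm{Ass}(I_{k-d})\\ \mathfrak{q}\in\mathrm{Ass}(J_{d+1})}}\bigl(\mathrm{v}_{\mathfrak{p}}(I_{k-d})+\mathrm{v}_{\mathfrak{q}}(J_{d+1})\bigr),$$ where the minimum is over all integers $d$ satisfying the displayed conditions. Moreover, when $(I+J)_k$ is a proper ideal (so that its $\mathrm{v}$-number is defined), $$\mathrm{v}((I+J)_k)=\min_{\substack{0\le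 d<k\\ \mathfrak{p}\in\mathrm{Ass}(I_{k-d})\\ \mathfrak{q}\in\mathrm{Ass}(J_{d+1})\\ \mathfrak{p}+\mathfrak{q}\in\mathrm{Ass}((I+J)_k)}}\bigl(\mathrm{v}_{\mathfrak{p}}(I_{k-d})+\mathrm{v}_{\mathfrak{q}}(J_{d+1})\bigr),$$ where the minimum is over all triples $(d,\mathfrak{p},\mathfrak{q})$ satisfying the displayed conditions.
   Context: All polynomial rings carry the standard grading. Let $R=\bigoplus_{d\ge0}R_d$ be a standard graded polynomial ring over $K$ and $L\subset R$ a proper graded ideal; $\mathrm{Ass}(L)$ denotes the set of associated primes of $L$ (i.e. of $R/L$). For $f\in R$, $L:f=\{u\in R\mid uf\in L\}$. For $\mathfrak{p}\in\mathrm{Ass}(L)$ the local $\mathrm{v}$-number is $\mathrm{v}_{\mathfrak{p}}(L)=\min\{d\ge 0\mid \exists f\in R_d \text{ with } L:f=\mathfrak{p}\}$, and the $\mathrm{v}$-number is $\mathrm{v}(L)=\min\{d\ge0\mid \exists f\in R_d,\ \mathfrak{p}\in\mathrm{Ass}(L)\text{ with }L:f=\mathfrak{p}\}=\min\{\mathrm{v}_{\mathfrak{p}}(L)\mid\mathfrak{p}\in\mathrm{Ass}(L)\}$. A monomial ideal is an ideal generated by monomials; a monomial prime ideal is a prime ideal generated by a subset of the variables. A graded filtration of $R$ is a family $\{L_k\}_{k\ge0}$ of graded ideals of $R$ with $L_0=R$, $L_{k+1}\subseteq L_k$ for all $k\ge0$, and $L_kL_r\subseteq L_{k+r}$ for all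 $k,r\ge0$. For a graded ideal $L$ of $R$, a graded filtration $\{L_k\}$ is a graded $L$-filtration if $L^k\subseteq L_k$ for all $k\ge1$. For ideals $I'\subset A$ and $J'\subset B$, the sum $I'+J'$ means $I'S+J'S$ and the product $I'J'$ means $(I'S)(J'S)$, as ideals of $S$. *)

(* Defs.v *)
From mathcomp Require Import all_boot all_order all_algebra.
From mathcomp Require Import boolp classical_sets.
From mathcomp Require Import mpoly.

Set Implicit Arguments.
Unset Strict Implicit.
Unset Printing Implicit Defensive.

Import GRing.Theory.
Local Open Scope classical_set_scope.
Local Open Scope ring_scope.

(* Ideals are Prop-valued sets; unlike the ideals of ring_quotient.v they need
   not be proper nor decidable (a filtration contains the unit ideal). *)
Section Ideals.
Variable R : comNzRingType.
Implicit Types L M p : set R.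

Definition is_ideal L : Prop :=
  [/\ L 0, forall u v, L u -> L v -> L (u + v) & forall a u, L u -> L (a * u)].

Definition ideal_gen (G : set R) : set R := smallest is_ideal G.

Definition ideal_add L M : set R := [set u + v | u in L & v in M].

Definition ideal_mul L M : set R := ideal_gen [set u * v | u in L & v in M].

Definition ideal_pow L (k : nat) : set R := iter k (ideal_mul L) setT.

Definition colon L (f : R) : set R := [set u | L (u * f)].

Definition is_prime p : Prop :=
  [/\ is_ideal p, ~ p 1 & forall u v, p (u * v) -> p u \/ p v].

(* p is prime and is the annihilator of the class of some f in R / L. *)
Definition Ass L : set (set R) :=
  [set p | is_prime p /\ exists f, colon L f = p].

End Ideals.

Definition is_min (P : set nat) (m : nat) : Prop :=
  P m /\ forall a, P a -> (m <= a)%N.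

(* The minimum of P, with the junk value 0 when P is empty. *)
Definition natmin (P : set nat) : nat := xget 0%N [set m | is_min P m].

Section Polynomials.
Variables (K : fieldType) (n : nat).
Implicit Types (L p : set {mpoly K[n]}) (F : nat -> set {mpoly K[n]}).

(* L contains the homogeneous components of each of its elements. *)
Definition is_graded_ideal L : Prop :=
  is_ideal L /\ forall f d, L f -> L (pihomog mdeg d f).

Definition is_monomial_ideal L : Prop :=
  exists M : set 'X_{1..n}, L = ideal_gen [set 'X_[K, m] | m in M].

Definition is_monomial_prime p : Prop :=
  is_prime p /\ exists V : {set 'I_n}, p = ideal_gen [set 'X_i | i in [set` V]].

(* For a graded ideal L and p in Ass L, the set below is nonempty. *)
Definition local_vnumber L p : nat :=
  natmin [set d | exists f : {mpoly K[n]}, f \is d.-homog /\ colon L f = p].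

(* For a proper graded ideal L, the set below is nonempty. *)
Definition vnumber L : nat :=
  natmin [set d | exists (f : {mpoly K[n]}) p,
                    [/\ f \is d.-homog, Ass L p & colon L f = p]].

Record graded_filtration F : Prop := GradedFiltration {
  filtration_graded : forall k, is_graded_ideal (F k);
  filtration0 : F 0%N = setT;
  filtrationS : forall k, F k.+1 `<=` F k;
  filtrationM : forall k r, ideal_mul (F k) (F r) `<=` F (k + r)%N
}.

Definition graded_filtration_of L F : Prop :=
  graded_filtration F /\ forall k, (0 < k)%N -> ideal_pow L k `<=` F k.

Definition monomial_terms F : Prop := forall k, is_monomial_ideal (F k).

Definition colon_condition F : Prop :=
  forall k p (m : 'X_{1..n}), (0 < k)%N ->
    Ass (F k) p -> colon (F k) 'X_[m] = p -> F k.-1 'X_[m].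

End Polynomials.

Section TwoSetsOfVariables.
Variables (K : fieldType) (n m : nat).

(* S = K[x_1..x_n, y_1..y_m]: the x's come first, then the y's. *)
Definition inl_mpoly (f : {mpoly K[n]}) : {mpoly K[n + m]} :=
  f \mPo [tuple 'X_(lshift m i) | i < n].

Definition inr_mpoly (g : {mpoly K[m]}) : {mpoly K[n + m]} :=
  g \mPo [tuple 'X_(rshift n j) | j < m].

Definition extl (I : set {mpoly K[n]}) : set {mpoly K[n + m]} :=
  ideal_gen [set inl_mpoly f | f in I].

Definition extr (J : set {mpoly K[m]}) : set {mpoly K[n + m]} :=
  ideal_gen [set inr_mpoly g | g in J].

Definition sum_ext (I : set {mpoly K[n]}) (J : set {mpoly K[m]}) :
  set {mpoly K[n + m]} := ideal_add (extl I) (extr J).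

Definition mul_ext (I : set {mpoly K[n]}) (J : set {mpoly K[m]}) :
  set {mpoly K[n + m]} := ideal_mul (extl I) (extr J).

Definition sum_filtration (I : nat -> set {mpoly K[n]})
    (J : nat -> set {mpoly K[m]}) (k : nat) : set {mpoly K[n + m]} :=
  \big[@ideal_add {mpoly K[n + m]}/[set 0]]_(i < k.+1) mul_ext (I i) (J (k - i)%N).

End TwoSetsOfVariables.

(* Main.v *)
Require Import Defs.
From mathcomp Require Import all_boot all_order all_algebra.
From mathcomp Require Import boolp classical_sets.
From mathcomp Require Import mpoly.
From mathcomp Require Import zify.

(** Why the formulas hold. For a monomial ideal L, a prime of the form L : f is
    generated by variables and equals L : u for some monomial u of f
    (prime_colon_msupp, colon_monomial). Therefore v_p(L) is the least degree of
    a monomial u with L : u = p (local_vnumberP), and v(L) is the least degree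
    of a monomial u with L : u prime (vnumberP); a proper L has such a u
    (exists_prime_colon).

    It remains to describe the monomials x^a y^b whose colon in the sum ideal
    (I + J)_k is a given prime p + q. They are exactly those for which some
    d < k satisfies I_{k-d} : x^a = p and J_{d+1} : y^b = q. The colon condition
    is what makes the two filtrations interlock. If these two equations hold, it
    gives x^a in I_{k-d-1} and y^b in J_d, and one more step on either side
    enters (I + J)_k, while monomials that make neither step stay outside
    (colon_glue). In the other direction, d is taken as the last step of the
    filtration J that contains y^b; the colon by x^a y^b then restricts to
    I_{k-d} : x^a on the variables x and to J_{k-e} : y^b on the variables y,
    where e is the analogous step for x^a, and the colon condition forces
    k - e = d + 1 (colon_split).

    As the degree of x^a y^b is the sum of the degrees of its two parts,
    minimizing the degree over all such pairs gives the first formula. For the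
    second one, every prime colon ideal of the sum ideal is monomial, hence of
    the form p + q (prime_split). *)

Set Implicit Arguments.
Unset Strict Implicit.
Unset Printing Implicit Defensive.

Import Order.TTheory GRing.Theory.
Local Open Scope classical_set_scope.
Local Open Scope ring_scope.

(** * Ideals, colons and primes *)

Section Ideal.
Variable R : comNzRingType.
Implicit Types (L : set R) (G : set R).

Lemma idealN L u : is_ideal L -> L u -> L (- u).
Proof. by move=> [_ _ LM] Lu; rewrite -mulN1r; apply: LM. Qed.

Lemma idealBr L u v : is_ideal L -> L v -> L (u - v) <-> L u.
Proof.
move=> idL Lv; have [_ LD _] := idL.
split=> Lu; last by apply: LD => //; apply: idealN.
by rewrite -[u](subrK v); apply: LD.
Qed.

Lemma ideal_sum L (T : eqType) (r : seq T) (F : T -> R) :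
  is_ideal L -> (forall i, i \in r -> L (F i)) -> L (\sum_(i <- r) F i).
Proof.
by move=> [L0 LD _] LF; rewrite big_seq; apply: (big_ind L).
Qed.

Lemma is_ideal_gen G : is_ideal (ideal_gen G).
Proof.
split=> [A [[]]//|u v Gu Gv A AG|a u Gu A AG]; have [[_ AD AM] _] := AG.
  by apply: AD; [apply: Gu|apply: Gv].
by apply: AM; apply: Gu.
Qed.

Lemma sub_ideal_gen G u : G u -> ideal_gen G u.
Proof. exact: sub_gen_smallest. Qed.

Lemma ideal_gen_min G L : is_ideal L -> G `<=` L -> ideal_gen G `<=` L.
Proof. exact: smallest_sub. Qed.

Lemma colon_prime_mul L f g p :
  is_prime p -> colon L f = p -> ~ p g -> colon L (f * g) = p.
Proof.
move=> [[_ _ pM] _ pP] Lf pg; apply/seteqP; split=> u; rewrite /colon /=.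
  move=> Lu; have /pP[]// : p (u * g) by rewrite -Lf /colon /= mulrAC -mulrA.
move=> pu; have : p (u * g) by rewrite mulrC; apply: pM.
by rewrite -Lf /colon /= mulrAC -mulrA.
Qed.

(** The product of elements witnessing that no L i lies in p stays outside the
    prime p: a prime containing a finite intersection of ideals contains one of
    them. *)
Lemma prime_avoid_seq (T : eqType) p (s : seq T) (L : T -> set R) :
  is_prime p -> (forall i, is_ideal (L i)) ->
  (forall i, i \in s -> ~ L i `<=` p) ->
  exists2 g, ~ p g & forall i, i \in s -> L i g.
Proof.
move=> [_ p1 pP] idL; elim: s => [|i s IHs] Ls; first by exists 1.
have [|g pg Lg] := IHs; first by move=> j js; apply: Ls; rewrite inE js orbT.
have [h [Lh ph]] : exists h, L i h /\ ~ p h.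
  apply: contrapT => Nh; apply: (Ls i (mem_head _ _)) => h Lh.
  by apply: contrapT => ph; apply: Nh; exists h.
exists (h * g) => [/pP[]//|j]; rewrite inE => /predU1P[->|/Lg Ljg].
  by case: (idL i) => _ _ LM; rewrite mulrC; apply: LM.
by case: (idL j) => _ _; apply.
Qed.

End Ideal.

(** * Monomial ideals as up-sets of exponents *)

Section MonomialIdeal.
Variables (K : fieldType) (n : nat).
Implicit Types (U V : set 'X_{1..n}) (L p : set {mpoly K[n]}).

Definition upset U := forall a c, U a -> U (a + c)%MM.

(** A monomial ideal is the span of its monomials, so it is recorded by an
    up-set of exponents, and sums, products, extensions and colons by monomials
    become set operations on exponents. *)
Definition mideal U : set {mpoly K[n]} := [set f | {in msupp f, forall a, U a}].

Lemma midealX U a : mideal U 'X_[a] <-> U a.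
Proof.
split=> [|Ua b]; first by apply; rewrite msuppX inE.
by rewrite msuppX inE => /eqP->.
Qed.

Lemma mideal_inj U V : mideal U = mideal V -> U = V.
Proof.
by move=> UV; apply/seteqP; split=> a; rewrite -!midealX UV.
Qed.

Lemma mideal_is_ideal U : upset U -> is_ideal (mideal U).
Proof.
move=> upU; split=> [a|f g Uf Ug a /msuppD_le|g f Uf a /msuppM_le].
- by rewrite msupp0.
- by rewrite mem_cat => /orP[/Uf|/Ug].
- by case/allpairsP=> -[b c] /= [_ /Uf Uc ->]; rewrite addmC; apply: upU.
Qed.

Lemma mideal_sub U L :
  is_ideal L -> (forall a, U a -> L 'X_[a]) -> mideal U `<=` L.
Proof.
move=> idL UL f Uf; rewrite [f]mpolyE; apply: ideal_sum => // a /Uf Ua.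
by rewrite -mul_mpolyC; case: idL => _ _; apply; apply: UL.
Qed.

(** How generated ideals are computed below: the inclusion in [mideal U] is
    checked on generators, the converse on monomials. *)
Lemma mideal_eq U L : upset U -> is_ideal L ->
  L `<=` mideal U -> (forall a, U a -> L 'X_[a]) -> L = mideal U.
Proof. by move=> upU idL LU UL; apply/seteqP; split=> //; apply: mideal_sub. Qed.

Lemma monomial_idealP L :
  is_monomial_ideal L -> exists2 U, upset U & L = mideal U.
Proof.
case=> M ->; pose U := [set b | exists a c, M a /\ b = (a + c)%MM].
have upU : upset U.
  by move=> _ d [a [c [Ma ->]]]; exists a, (c + d)%MM; rewrite addmA.
exists U => //; apply: mideal_eq => //; first exact: is_ideal_gen.
  apply: ideal_gen_min; first exact: mideal_is_ideal.
  by move=> _ [a Ma <-]; apply/midealX; exists a, 0%MM; rewrite addm0.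
move=> _ [a [c [Ma ->]]]; rewrite mpolyXD mulrC.
have [_ _] := is_ideal_gen [set 'X_[K, m] | m in M]; apply.
by apply: sub_ideal_gen; exists a.
Qed.

Lemma monomial_primeP p :
  is_monomial_prime p -> exists2 U, upset U & p = mideal U.
Proof.
case=> _ [V pE]; apply: monomial_idealP; exists [set U_(i)%MM | i in [set` V]].
by rewrite pE image_comp.
Qed.

Lemma upset_colon U a : upset U -> upset [set c | U (c + a)%MM].
Proof. by move=> upU c d /= Uca; rewrite -addmA (addmC d) addmA; apply: upU. Qed.

Lemma colon_mideal U a : colon (mideal U) 'X_[a] = mideal [set c | U (c + a)%MM].
Proof.
apply/seteqP; split=> f Uf c.
  move=> cf; rewrite /= addmC; apply: Uf.
  by rewrite (perm_mem (msuppMX _ _)) map_f.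
by rewrite (perm_mem (msuppMX _ _)) => /mapP[b /Uf Ub ->]; rewrite addmC.
Qed.

Lemma prime_midealD U a b : is_prime (mideal U) -> U (a + b)%MM -> U a \/ U b.
Proof.
by case=> _ _ pP; rewrite -!midealX mpolyXD => /pP.
Qed.

Lemma prime_mideal0 U : is_prime (mideal U) -> ~ U 0%MM.
Proof. by case=> _ p1 _; rewrite -midealX mpolyX0. Qed.

Definition mtail f : {mpoly K[n]} := f - f@_(mlead f) *: 'X_[mlead f].

Lemma size_msupp_mtail f : f != 0 -> (size (msupp (mtail f)) < size (msupp f))%N.
Proof.
move=> f_neq0; rewrite (perm_size (msupp_rem _ _)) size_rem ?mlead_supp //.
by case: (msupp f) (mlead_supp f_neq0).
Qed.

Lemma ideal_mtail L f : is_ideal L -> L 'X_[mlead f] -> L (mtail f) <-> L f.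
Proof.
move=> idL Lf; apply: idealBr => //.
by rewrite -mul_mpolyC; case: idL => _ _; apply.
Qed.

(** When [a + mlead f] lies in [U], the lead term of [f] times ['X_[a]] is zero
    modulo the ideal, so dropping it does not affect the colon. *)
Lemma colon_mtail U f a : upset U -> U (a + mlead f)%MM ->
  colon (mideal U) (mtail f * 'X_[a])
  = colon (mideal U) (f * 'X_[a]).
Proof.
move=> upU Uaf; have idU := mideal_is_ideal upU; have [_ _ UM] := idU.
have mtailE u : mideal U (u * (mtail f * 'X_[a])) <-> mideal U (u * (f * 'X_[a])).
  rewrite mulrBl mulrBr; apply: idealBr => //; apply: (UM).
  rewrite -scalerAl -mul_mpolyC -mpolyXD.
  by apply: (UM); apply/midealX; rewrite addmC.
by apply/seteqP; split=> u; move: (mtailE u); rewrite /colon /= => -[].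
Qed.

(** Associated primes of monomial ideals are monomial. If [u] lies in
    [p = L : f] then the product of the lead monomials of [u] and [f] lies in
    [L]. Should the lead monomial of [u] lie outside [p], then multiplying [f]
    by it keeps the colon equal to [p], yet makes the lead term of [f]
    superfluous: [p] is the colon of a polynomial with fewer terms. So, by
    induction on the number of terms of [f], one may assume that [p] contains
    the lead monomials of its elements, and then it contains all their
    monomials. *)
Lemma prime_colon_msupp U f p : upset U -> is_prime p -> colon (mideal U) f = p ->
  forall u, p u -> {in msupp u, forall a, p 'X_[a]}.
Proof.
move=> upU pP; have idU := mideal_is_ideal upU.
have [[p0 pD pM] p1 _] := pP.
move: {2}_.+1 (ltnSn (size (msupp f))) => k.
elim: k f => // k IHk f; rewrite ltnS => size_f Uf.
have f_neq0 : f != 0.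
  apply/eqP=> f0; apply: p1; rewrite -Uf f0 /colon /= mulr0.
  by case: idU.
have lead_f u : p u -> u != 0 -> U (mlead u + mlead f)%MM.
  rewrite -{1}Uf => Lu u_neq0; rewrite -mleadM //; apply: Lu.
  by rewrite mlead_supp // mulf_neq0.
have [[u [pu u_neq0 Nplead]]|all_lead] :=
  pselect (exists u, [/\ p u, u != 0 & ~ p 'X_[mlead u]]).
  apply: (IHk (mtail f * 'X_[mlead u])).
    rewrite (perm_size (msuppMX _ _)) size_map.
    exact: leq_trans (size_msupp_mtail f_neq0) size_f.
  rewrite colon_mtail //; last exact: lead_f.
  exact: colon_prime_mul.
elim/mleadrect=> u IHu pu a.
have [->|u_neq0] := eqVneq u 0; first by rewrite msupp0.
have plead : p 'X_[mlead u].
  by apply: contrapT => Np; apply: all_lead; exists u.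
have [->//|neq_a] := eqVneq a (mlead u) => au.
have av : a \in msupp (mtail u).
  by rewrite (perm_mem (msupp_rem _ _)) mem_rem_uniq // !inE neq_a.
apply: (IHu (mtail u)) => //.
  apply: ltm_mleadD => //; rewrite -/(mtail u).
  by apply: contraL av => /eqP ->; rewrite msupp0.
by apply/ideal_mtail.
Qed.

(** Since [p] is monomial, [p] is contained in [L : 'X_[a]] for every term [a]
    of [f]; conversely the intersection of these colons is contained in
    [L : f = p], so the prime [p] contains one of them. Such an [a] has the
    degree of [f] when [f] is homogeneous, which is why v-numbers of monomial
    ideals are minima of degrees of monomials. *)
Lemma colon_monomial U f p : upset U -> is_prime p -> colon (mideal U) f = p ->
  exists2 a, a \in msupp f & colon (mideal U) 'X_[a] = p.
Proof.
move=> upU pP Uf; have idU := mideal_is_ideal upU.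
have idC i : is_ideal (colon (mideal U) 'X_[i]).
  by rewrite colon_mideal; apply: mideal_is_ideal; apply: upset_colon.
suff [a af Ca] : exists2 a, a \in msupp f & colon (mideal U) 'X_[a] `<=` p.
  exists a => //; apply/seteqP; split=> // u pu; rewrite colon_mideal => c cu /=.
  have := prime_colon_msupp upU pP Uf pu cu; rewrite -Uf /colon /=; apply.
  by rewrite mulrC (perm_mem (msuppMX _ _)) map_f.
apply: contrapT => Na.
have [|g pg Cg] := prime_avoid_seq (s := msupp f) pP idC.
  by move=> i fi Ci; apply: Na; exists i.
apply: pg; rewrite -Uf /colon /= [f]mpolyE mulr_sumr; apply: ideal_sum => // a /Cg.
by rewrite /colon /= -scalerAr -mul_mpolyC; case: idU => _ _; apply.
Qed.

Lemma ass_monomial U p : upset U -> Ass (mideal U) p ->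
  exists a, colon (mideal U) 'X_[a] = p.
Proof. by move=> upU [pP [f]] /(colon_monomial upU pP)[a _]; exists a. Qed.

(** The lead monomial of [u * v] is the sum of those of [u] and [v], so one of
    them lies in [U]; removing that term shortens a factor without changing
    which of [u], [v], [u * v] lie in the ideal. *)
Lemma mideal_prime U : upset U -> ~ U 0%MM ->
  (forall a b, U (a + b)%MM -> U a \/ U b) -> is_prime (mideal U).
Proof.
move=> upU U0 UD; have idU := mideal_is_ideal upU; have [L0 _ UM] := idU.
split=> // [|u v]; first by rewrite -mpolyX0 midealX.
move: {2}_.+1 (ltnSn (size (msupp u) + size (msupp v))) => k.
elim: k u v => // k IHk u v; rewrite ltnS => size_uv Uuv.
have [->|u_neq0] := eqVneq u 0; first by left.
have [->|v_neq0] := eqVneq v 0; first by right.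
have [|Uu|Uv] := UD (mlead u) (mlead v).
- by rewrite -mleadM //; apply: Uuv; rewrite mlead_supp // mulf_neq0.
- move/midealX: Uu => Uu; rewrite -(ideal_mtail idU Uu); apply: IHk.
    by apply: leq_trans size_uv; rewrite ltn_add2r size_msupp_mtail.
  rewrite /mtail mulrBl; apply/idealBr => //.
  by rewrite mulrC -mul_mpolyC; do 2!apply: (UM).
- move/midealX: Uv => Uv; rewrite -(ideal_mtail idU Uv); apply: IHk.
    by apply: leq_trans size_uv; rewrite ltn_add2l size_msupp_mtail.
  rewrite /mtail mulrBr; apply/idealBr => //.
  by rewrite -mul_mpolyC; do 2!apply: (UM).
Qed.

Lemma mnm_gt0_split (c : 'X_{1..n}) i : (0 < c i)%N -> c = (c - U_(i) + U_(i))%MM.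
Proof.
move=> ci; rewrite submK //; apply/mnm_lepP=> j.
by rewrite mnm1E; case: eqP => // <-.
Qed.

(** Choose a monomial [a] outside the ideal for which the set [W a] of variables
    taking it into the ideal is as large as possible. On a path of
    multiplications by variables that starts at [a], the set [W] can only grow
    as long as the path stays outside the ideal, hence it is constant; so the
    step that enters the ideal uses a variable of [W a], and the colon is
    generated by these variables. *)
Lemma exists_prime_colon U : upset U -> mideal U <> setT ->
  exists a, is_prime (colon (mideal U) 'X_[a]).
Proof.
move=> upU UT.
have [a0 Ua0] : exists a, ~ U a.
  apply: contrapT => NU; apply: UT; apply/seteqP; split=> // f _ a _.
  by apply: contrapT => Ua; apply: NU; exists a.
pose W a : {set 'I_n} := [set i | `[< U (a + U_(i))%MM >]]%SET.
pose Q k := `[< exists a, ~ U a /\ #|W a| = k >].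
have exQ : exists k, Q k by exists #|W a0|; apply/asboolP; exists a0.
have ubQ k : Q k -> (k <= n)%N.
  by move=> /asboolP[a [_ <-]]; rewrite -[leqRHS](card_ord n) max_card.
case: (ex_maxnP exQ ubQ) => _ /asboolP[a [Ua <-]] maxW.
have UaP c : U (c + a)%MM <-> exists2 i, i \in W a & (0 < c i)%N.
  split=> [|[i]]; last first.
    rewrite !inE => Uai /mnm_gt0_split->.
    by rewrite -addmA addmC (addmC _ a); apply: upU.
  move=> Uca; apply: contrapT => Nc.
  move: {2}_.+1 (ltnSn (mdeg c)) => k.
  elim: k c Uca Nc => // k IHk c Uca Nc; rewrite ltnS => deg_c.
  have [c0|/existsP[i]] := boolP [forall i, c i == 0%N].
    apply: Ua; suff c_0 : c = 0%MM by rewrite c_0 add0m in Uca.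
    by apply/mnmP=> i; rewrite mnm0E; apply/eqP/(forallP c0).
  rewrite -lt0n => ci; set d := (c - U_(i))%MM; have cE := mnm_gt0_split ci.
  rewrite -/d in cE.
  have Nd : ~ exists2 i, i \in W a & (0 < d i)%N.
    case=> j Wj dj; apply: Nc; exists j => //.
    by rewrite cE mnmDE addn_gt0 dj.
  have Uda : ~ U (d + a)%MM.
    move=> Uda; apply: (IHk _ Uda) => //.
    by apply: leq_trans deg_c; rewrite cE mdegD mdeg1 addn1.
  have subW : W a \subset W (d + a)%MM.
    apply/fintype.subsetP=> j; rewrite !inE => Uaj.
    by rewrite -addmA addmC; apply: upU.
  have /eqP eqW : W a == W (d + a)%MM.
    rewrite eqEcard subW; apply: maxW; apply/asboolP.
    by exists (d + a)%MM.
  apply: Nc; exists i => //; rewrite eqW !inE.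
  by rewrite -addmA (addmC a) addmA -cE.
exists a; rewrite colon_mideal; apply: mideal_prime.
- exact: upset_colon.
- by rewrite /= add0m.
- move=> b c /UaP[i Wi]; rewrite mnmDE addn_gt0 => /orP[bi|ci].
    by left; apply/UaP; exists i.
  by right; apply/UaP; exists i.
Qed.

End MonomialIdeal.

(** * Renaming the variables along an injection *)

Section Renaming.
Variables (K : fieldType) (n N : nat) (s : 'I_n -> 'I_N).
Hypothesis s_inj : injective s.
Implicit Types (a : 'X_{1..n}) (w : 'X_{1..N}).

Definition pull w : 'X_{1..n} := [multinom w (s i) | i < n].
Definition push a : 'X_{1..N} := (\sum_(i < n) U_(s i) *+ a i)%MM.

Lemma pullD w v : pull (w + v) = (pull w + pull v)%MM.
Proof. by apply/mnmP=> i; rewrite mnmDE !mnmE. Qed.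

Lemma pushD a b : push (a + b) = (push a + push b)%MM.
Proof.
apply/mnmP=> j; rewrite mnmDE !mnm_sumE -big_split.
by apply: eq_bigr => i _; rewrite !mulmnE mnmDE mulnDr.
Qed.

Lemma push0 : push 0 = 0%MM.
Proof.
by apply/mnmP=> j; rewrite mnm_sumE big1 ?mnm0E // => i; rewrite mulmnE mnm0E muln0.
Qed.

Lemma push_out a j : (forall i, s i != j) -> push a j = 0%N.
Proof.
move=> sj; rewrite mnm_sumE big1 // => i _.
by rewrite mulmnE mnm1E (negbTE (sj i)) mul0n.
Qed.

Lemma push_in a i : push a (s i) = a i.
Proof.
rewrite mnm_sumE (bigD1 i) //= big1 => [|j ji].
  by rewrite mulmnE mnm1E eqxx mul1n addn0.
by rewrite mulmnE mnm1E (inj_eq s_inj) (negbTE ji) mul0n.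
Qed.

Lemma pushK : cancel push pull.
Proof. by move=> a; apply/mnmP=> i; rewrite mnmE push_in. Qed.

Lemma push_pull_le w : (push (pull w) <= w)%MM.
Proof.
apply/mnm_lepP=> j; have [/existsP[i /eqP<-]|sj] := boolP [exists i, s i == j].
  by rewrite push_in mnmE.
by rewrite push_out // => i; apply: contra sj => sij; apply/existsP; exists i.
Qed.

Definition rename (f : {mpoly K[n]}) : {mpoly K[N]} :=
  f \mPo [tuple 'X_(s i) | i < n].

Lemma renameX a : rename 'X_[a] = 'X_[push a].
Proof.
rewrite /rename comp_mpolyX -mprodXnE.
by apply: eq_bigr => i _; rewrite tnth_mktuple.
Qed.

Lemma upset_pull U : upset U -> upset (pull @^-1` U).
Proof. by move=> upU w v /= Uw; rewrite pullD; apply: upU. Qed.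

(** Every monomial is a multiple of the renaming of its pulled back part, so the
    extended ideal only looks at the renamed variables. *)
Lemma extension_mideal (U : set 'X_{1..n}) : upset U ->
  ideal_gen [set rename f | f in mideal U] = mideal (pull @^-1` U).
Proof.
move=> upU; have upU' := upset_pull upU.
apply: mideal_eq => //; first exact: is_ideal_gen.
  apply: ideal_gen_min; first exact: mideal_is_ideal.
  move=> _ [f Uf <-]; rewrite /rename comp_mpolyEX.
  apply: ideal_sum => [|a /Uf Ua]; first exact: mideal_is_ideal.
  rewrite -mul_mpolyC -/(rename _) renameX.
  case: (mideal_is_ideal K upU') => _ _; apply; apply/midealX.
  by rewrite /= pushK.
move=> w /= Uw; rewrite -(submK (push_pull_le w)) mpolyXD.
case: (is_ideal_gen [set rename f | f in mideal U]) => _ _; apply.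
by apply: sub_ideal_gen; exists 'X_[pull w]; rewrite ?renameX // midealX.
Qed.

End Renaming.

(** * Sums of monomial ideals *)

Section IdealSum.
Variables (K : fieldType) (n : nat).
Implicit Types U V : set 'X_{1..n}.

Lemma is_ideal_add (R : comNzRingType) (L M : set R) :
  is_ideal L -> is_ideal M -> is_ideal (ideal_add L M).
Proof.
move=> [L0 LD LM] [M0 MD MM]; split.
- by exists 0 => //; exists 0; rewrite ?addr0.
- move=> _ _ [u Lu [v Mv <-]] [u' Lu' [v' Mv' <-]].
  by exists (u + u'); [apply: LD|exists (v + v'); rewrite 1?addrACA //; apply: MD].
- move=> a _ [u Lu [v Mv <-]].
  by exists (a * u); [apply: LM|exists (a * v); rewrite ?mulrDr //; apply: MM].
Qed.

Lemma ideal_add_mideal U V : upset U -> upset V ->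
  ideal_add (mideal U) (mideal V) = mideal (U `|` V) :> set {mpoly K[n]}.
Proof.
move=> upU upV.
have [idU idV] := (mideal_is_ideal K upU, mideal_is_ideal K upV).
apply: mideal_eq; first by move=> a c [/upU|/upV] UV; [left|right].
- exact: is_ideal_add.
- move=> _ [f Uf [g Vg <-]] a /msuppD_le; rewrite mem_cat.
  by case/orP=> [/Uf|/Vg]; [left|right].
- move=> a [Ua|Va].
    by exists 'X_[a]; [apply/midealX|exists 0; [case: idV|rewrite addr0]].
  by exists 0; [case: idU|exists 'X_[a]; [apply/midealX|rewrite add0r]].
Qed.

Lemma mideal0 : mideal set0 = [set 0] :> set {mpoly K[n]}.
Proof.
apply/seteqP; split=> [f f0|_ -> a]; last by rewrite msupp0.
apply: msuppnil0; move: f0; rewrite /mideal /=.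
by case: (msupp f) => // a r /(_ a (mem_head _ _)).
Qed.

Lemma big_ideal_add_mideal (T : eqType) (r : seq T) (W : T -> set 'X_{1..n}) :
  (forall i, upset (W i)) ->
  \big[@ideal_add {mpoly K[n]}/[set 0]]_(i <- r) mideal (W i)
  = mideal [set w | exists2 i, i \in r & W i w].
Proof.
move=> upW; elim: r => [|i r IHr].
  by rewrite big_nil -mideal0; congr mideal; apply/seteqP; split=> // w [].
rewrite big_cons IHr ideal_add_mideal //; last first.
  by move=> a c [j rj /upW Wj]; exists j.
congr mideal; apply/seteqP; split=> w /=.
  by move=> [Ww|[j rj Ww]]; [exists i|exists j]; rewrite ?inE ?eqxx ?rj ?orbT.
by move=> [j]; rewrite inE => /predU1P[->|rj] Ww; [left|right; exists j].
Qed.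

End IdealSum.

(** * Monomial ideals in two sets of variables *)

Section TwoSetsOfVariables.
Variables (K : fieldType) (n m : nat).
Implicit Types (a : 'X_{1..n}) (b : 'X_{1..m}) (w : 'X_{1..n + m}).
Implicit Types (P : set 'X_{1..n}) (Q : set 'X_{1..m}).

Definition xpart w : 'X_{1..n} := pull (@lshift n m) w.
Definition ypart w : 'X_{1..m} := pull (@rshift n m) w.
Definition xmnm a : 'X_{1..n + m} := push (@lshift n m) a.
Definition ymnm b : 'X_{1..n + m} := push (@rshift n m) b.

Lemma xpartD w v : xpart (w + v) = (xpart w + xpart v)%MM.
Proof. exact: pullD. Qed.
Lemma ypartD w v : ypart (w + v) = (ypart w + ypart v)%MM.
Proof. exact: pullD. Qed.

Lemma xmnmK : cancel xmnm xpart. Proof. exact/pushK/lshift_inj. Qed.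
Lemma ymnmK : cancel ymnm ypart. Proof. exact/pushK/rshift_inj. Qed.

Lemma xpart_ymnm b : xpart (ymnm b) = 0%MM.
Proof.
apply/mnmP=> i; rewrite mnmE mnm0E push_out // => j.
by rewrite eq_rlshift.
Qed.

Lemma ypart_xmnm a : ypart (xmnm a) = 0%MM.
Proof.
apply/mnmP=> i; rewrite mnmE mnm0E push_out // => j.
by rewrite eq_lrshift.
Qed.

Lemma xpart_join a b : xpart (xmnm a + ymnm b) = a.
Proof. by rewrite xpartD xmnmK xpart_ymnm addm0. Qed.
Lemma ypart_join a b : ypart (xmnm a + ymnm b) = b.
Proof. by rewrite ypartD ymnmK ypart_xmnm add0m. Qed.

Lemma xy_join w : (xmnm (xpart w) + ymnm (ypart w))%MM = w.
Proof.
apply/mnmP=> j; rewrite mnmDE -[j]splitK; case: split => i /=.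
  rewrite [xmnm _ _]push_in; last exact: lshift_inj.
  by rewrite push_out ?addn0 ?mnmE // => k; rewrite eq_rlshift.
rewrite [ymnm _ _]push_in; last exact: rshift_inj.
by rewrite push_out ?add0n ?mnmE // => k; rewrite eq_lrshift.
Qed.

Lemma mdeg_parts w : mdeg w = (mdeg (xpart w) + mdeg (ypart w))%N.
Proof.
by rewrite !mdegE big_split_ord; congr addn; apply: eq_bigr => i _; rewrite mnmE.
Qed.

Lemma extl_mideal P : upset P ->
  extl (mideal P) = mideal (xpart @^-1` P) :> set {mpoly K[n + m]}.
Proof. exact/extension_mideal/lshift_inj. Qed.

Lemma extr_mideal Q : upset Q ->
  extr (mideal Q) = mideal (ypart @^-1` Q) :> set {mpoly K[n + m]}.
Proof. exact/extension_mideal/rshift_inj. Qed.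

Definition union_upset P Q := [set w | P (xpart w) \/ Q (ypart w)].

Lemma sum_ext_mideal P Q : upset P -> upset Q ->
  sum_ext (mideal P) (mideal Q) = mideal (union_upset P Q) :> set {mpoly K[n + m]}.
Proof.
move=> upP upQ; rewrite /sum_ext extl_mideal // extr_mideal //.
by rewrite ideal_add_mideal //; apply: upset_pull.
Qed.

Lemma mul_ext_mideal P Q : upset P -> upset Q ->
  mul_ext (mideal P) (mideal Q) = mideal [set w | P (xpart w) /\ Q (ypart w)]
    :> set {mpoly K[n + m]}.
Proof.
move=> upP upQ; rewrite /mul_ext extl_mideal // extr_mideal //.
have up : upset [set w | P (xpart w) /\ Q (ypart w)].
  by move=> w v [Pw Qw]; split; apply: upset_pull.
apply: mideal_eq => //; first exact: is_ideal_gen.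
  apply: ideal_gen_min; first exact: mideal_is_ideal.
  move=> _ [f Pf [g Qg <-]] w /msuppM_le/allpairsP[[u v] /= [/Pf Pu /Qg Qv ->]].
  split; rewrite ?xpartD ?ypartD; first exact: upP.
  by rewrite addmC; apply: upQ.
move=> w [Pw Qw]; rewrite -[w]xy_join mpolyXD; apply: sub_ideal_gen.
exists 'X_[xmnm (xpart w)]; first by apply/midealX; rewrite /= xmnmK.
by exists 'X_[ymnm (ypart w)] => //; apply/midealX; rewrite /= ymnmK.
Qed.

Definition sum_upset (U : nat -> set 'X_{1..n}) (V : nat -> set 'X_{1..m}) k :=
  [set w | exists i, [/\ (i <= k)%N, U i (xpart w) & V (k - i)%N (ypart w)]].

Lemma upset_sum U V k : (forall i, upset (U i)) -> (forall i, upset (V i)) ->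
  upset (sum_upset U V k).
Proof.
by move=> upU upV w v [i [ik Uw Vw]]; exists i; split=> //; apply: upset_pull.
Qed.

Lemma sum_filtration_mideal U V k :
  (forall i, upset (U i)) -> (forall i, upset (V i)) ->
  sum_filtration (fun i => mideal (U i)) (fun i => mideal (V i)) k
  = mideal (sum_upset U V k) :> set {mpoly K[n + m]}.
Proof.
move=> upU upV; rewrite /sum_filtration.
under eq_bigr do rewrite mul_ext_mideal //.
rewrite big_ideal_add_mideal; last first.
  by move=> i w v [Pw Qw]; split; apply: upset_pull.
congr mideal; apply/seteqP; split=> w /=.
  by move=> [i _ [Uw Vw]]; exists i; rewrite -ltnS ltn_ord.
move=> [i [ik Uw Vw]]; exists (Ordinal (ik : i < k.+1)%N) => //.
by rewrite mem_index_enum.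
Qed.

(** A monomial [x^a y^b] of a prime has [x^a] or [y^b] in it, so a monomial prime
    of the big ring is the sum of the extensions of its traces. *)
Lemma prime_split (W : set 'X_{1..n + m}) : upset W -> is_prime (@mideal K _ W) ->
  exists P Q, [/\ upset P, upset Q, is_prime (@mideal K _ P),
    is_prime (@mideal K _ Q) & W = union_upset P Q].
Proof.
move=> upW prW; have W0 := prime_mideal0 prW.
exists (xmnm @^-1` W), (ymnm @^-1` W).
have upP : upset (xmnm @^-1` W) by move=> a c /upW; rewrite /= /xmnm pushD; apply.
have upQ : upset (ymnm @^-1` W) by move=> a c /upW; rewrite /= /ymnm pushD; apply.
split=> //.
- apply: mideal_prime => //; first by rewrite /= /xmnm push0.
  by move=> a b /=; rewrite /xmnm pushD => /(prime_midealD prW).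
- apply: mideal_prime => //; first by rewrite /= /ymnm push0.
  by move=> a b /=; rewrite /ymnm pushD => /(prime_midealD prW).
- apply/seteqP; split=> w /=.
    by rewrite -{1}[w]xy_join => /(prime_midealD prW).
  move=> Ww; rewrite -[w]xy_join; case: Ww; first exact: upW.
  by rewrite addmC; apply: upW.
Qed.

End TwoSetsOfVariables.

(** * The v-numbers of monomial ideals *)

Section VNumber.
Variables (K : fieldType) (n : nat).
Implicit Types (U : set 'X_{1..n}) (p : set {mpoly K[n]}).

Lemma natminP (D : set nat) : D !=set0 -> is_min D (natmin D).
Proof.
case=> d Dd; have exD : exists d, `[< D d >] by exists d; apply/asboolP.
case: (ex_minnP exD) => b /asboolP Db minb.
apply: (@xgetPex _ 0%N [set c | is_min D c]); exists b; split=> // c Dc.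
by apply: minb; apply/asboolP.
Qed.

Lemma local_vnumberP U p : upset U -> Ass (mideal U) p ->
  is_min [set d | exists2 a, colon (mideal U) 'X_[a] = p & mdeg a = d]
         (local_vnumber (mideal U) p).
Proof.
move=> upU pA; have [pP _] := pA; have [a0 pE] := ass_monomial upU pA.
rewrite /local_vnumber; set D := (X in natmin X).
have <- : D = [set d | exists2 a, colon (mideal U) 'X_[a] = p & mdeg a = d].
  apply/seteqP; split=> [d [f [/dhomogP homf /(colon_monomial upU pP)[a af aE]]]|].
    by exists a => //; apply: homf.
  by move=> d [a aE <-]; exists 'X_[a]; rewrite dhomogX.
by apply: natminP; exists (mdeg a0), 'X_[a0]; rewrite dhomogX.
Qed.

Lemma vnumberP U : upset U -> mideal U <> setT :> set {mpoly K[n]} ->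
  is_min [set d | exists2 a, is_prime (colon (@mideal K n U) 'X_[a]) & mdeg a = d]
         (vnumber (@mideal K n U)).
Proof.
move=> upU UT; have [a0 pr0] := exists_prime_colon upU UT.
rewrite /vnumber; set D := (X in natmin X).
have DE d : D d <-> exists2 a, is_prime (colon (@mideal K n U) 'X_[a]) & mdeg a = d.
  split=> [[f [p [/dhomogP homf [pP _] /(colon_monomial upU pP)[a af aE]]]]|].
    by exists a; [rewrite aE|apply: homf].
  move=> [a aP <-]; exists 'X_[a], (colon (mideal U) 'X_[a]).
  by split; rewrite ?dhomogX //; split=> //; exists 'X_[a].
rewrite (_ : [set d | _] = D); last by apply/seteqP; split=> d /DE.
by apply: natminP; exists (mdeg a0); apply/DE; exists a0.
Qed.

End VNumber.

(** * Exponents of a filtration *)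

(** [exponent_colon] is the colon condition with the prime left implicit: any
    prime of the form [L : f] is associated to [L]. *)
Record exponent_filtration (K : fieldType) n (U : nat -> set 'X_{1..n}) : Prop := {
  exponent_upset : forall i, upset (U i);
  exponent0 : U 0%N = setT;
  exponent_le : forall i j, (i <= j)%N -> U j `<=` U i;
  exponent_colon : forall k a, (0 < k)%N ->
    is_prime (colon (@mideal K n (U k)) 'X_[a]) -> U k.-1 a
}.

Lemma filtration_exponents (K : fieldType) n (F : nat -> set {mpoly K[n]}) :
  graded_filtration F -> monomial_terms F -> colon_condition F ->
  exists2 U, exponent_filtration K U & F = fun i => mideal (U i).
Proof.
move=> [_ F0 FS _] Fmon Fcolon; pose U i := [set a | F i 'X_[a]].
have UE i : upset (U i) /\ F i = mideal (U i).
  have [V upV FE] := monomial_idealP (Fmon i).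
  suff -> : U i = V by [].
  by apply/seteqP; split=> a; rewrite /U /= FE midealX.
exists U; last by apply/funext=> i; case: (UE i).
split=> [i|||k a k_gt0 pr].
- by case: (UE i).
- by rewrite /U F0; apply/seteqP.
- move=> i j /subnK <- a; elim: (j - i)%N => //= d IHd Ua.
  by apply: IHd; apply: FS.
- apply: (Fcolon k _ a k_gt0 _ erefl); rewrite (UE k).2 //.
  by split=> //; exists 'X_[a].
Qed.

(** * Colons of the sum of two filtrations *)

Lemma jump_index (W : set nat) k : W 0%N -> ~ W k ->
  exists d, [/\ (d < k)%N, W d & ~ W d.+1].
Proof.
move=> W0; elim: k => // k IHk NWk1.
have [Wk|/IHk[d [dk Wd NWd]]] := pselect (W k); first by exists k.
by exists d; split=> //; apply: leqW.
Qed.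

Section Sum.
Variables (K : fieldType) (n m : nat).
Variables (U : nat -> set 'X_{1..n}) (V : nat -> set 'X_{1..m}).
Hypotheses (filU : exponent_filtration K U) (filV : exponent_filtration K V).
Implicit Types (P : set 'X_{1..n}) (Q : set 'X_{1..m}).
Implicit Types (p : set {mpoly K[n]}) (q : set {mpoly K[m]}).

Let upU i : upset (U i). Proof. exact: exponent_upset filU i. Qed.
Let upV i : upset (V i). Proof. exact: exponent_upset filV i. Qed.

(** The colon conditions place [a] in step [k - d - 1] and [b] in step [d].
    Hence moving [a] up to step [k - d], or [b] up to step [d + 1], puts the
    product into the sum ideal. If neither happens, the two factors reach steps
    at most [k - d - 1] and [d], one short of [k] in total. *)
Lemma colon_glue k d a b : (d < k)%N ->
  is_prime (colon (@mideal K n (U (k - d)%N)) 'X_[a]) ->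
  is_prime (colon (@mideal K m (V d.+1)) 'X_[b]) ->
  colon (mideal (sum_upset U V k)) 'X_[xmnm m a + ymnm n b]
  = sum_ext (colon (@mideal K n (U (k - d)%N)) 'X_[a])
            (colon (@mideal K m (V d.+1)) 'X_[b]).
Proof.
move=> dk pra prb.
have Ua : U (k - d).-1 a by apply: (exponent_colon filU) pra; rewrite subn_gt0.
have Vb : V d b by apply: (exponent_colon filV) prb.
rewrite !colon_mideal sum_ext_mideal; try exact: upset_colon.
congr mideal; apply/seteqP; split=> w;
  rewrite /sum_upset /union_upset /= !xpartD !ypartD !xmnmK !ymnmK;
  rewrite !xpart_ymnm !ypart_xmnm addm0 add0m.
  move=> [i [ik Ui Vi]]; have [le_i|lt_i] := leqP (k - d) i.
    by left; apply: (exponent_le filU) Ui.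
  right; apply: (exponent_le filV) Vi.
  lia.
move=> [Uw|Vw].
  exists (k - d)%N; split; rewrite ?leq_subr //.
  by rewrite subKn ?(ltnW dk) // addmC; apply: upV.
exists (k - d).-1; split; first lia; first by rewrite addmC; apply: upU.
suff -> : (k - (k - d).-1)%N = d.+1 by [].
lia.
Qed.

(** Let [d] and [e] be steps reached by [b] and [a] but not exceeded by them.
    A monomial [x^c] takes [x^a y^b] into the sum ideal exactly when it takes
    [x^a] into step [k - d], and symmetrically [y^c] must take [y^b] into step
    [k - e]; both colons are thus the given primes. As [x^a y^b] is outside the
    sum ideal, [e + d < k]; the colon condition for step [k - d] gives
    [k - d - 1 <= e]. So [k - e = d + 1]. *)
Lemma colon_split k (w : 'X_{1..n + m}) P Q :
  is_prime (@mideal K n P) -> is_prime (@mideal K m Q) -> upset P -> upset Q ->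
  colon (mideal (sum_upset U V k)) 'X_[w]
    = sum_ext (mideal P) (mideal Q) :> set {mpoly K[n + m]} ->
  exists d, [/\ (d < k)%N,
    colon (mideal (U (k - d)%N)) 'X_[xpart w] = mideal P :> set {mpoly K[n]} &
    colon (mideal (V d.+1)) 'X_[ypart w] = mideal Q :> set {mpoly K[m]}].
Proof.
move=> prP prQ upP upQ; set a := xpart w; set b := ypart w.
have P0 := prime_mideal0 prP; have Q0 := prime_mideal0 prQ.
rewrite colon_mideal sum_ext_mideal // => /mideal_inj/seteqP[sub1 sub2].
have PE c : P c <-> exists i, [/\ (i <= k)%N, U i (c + a)%MM & V (k - i)%N b].
  have := conj (sub1 (xmnm m c)) (sub2 (xmnm m c)).
  rewrite /sum_upset /union_upset /= xpartD ypartD xmnmK ypart_xmnm add0m.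
  by move=> [h1 h2]; split=> [Pc|/h1[]//]; apply: h2; left.
have QE c : Q c <-> exists i, [/\ (i <= k)%N, U i a & V (k - i)%N (c + b)%MM].
  have := conj (sub1 (ymnm n c)) (sub2 (ymnm n c)).
  rewrite /sum_upset /union_upset /= xpartD ypartD ymnmK xpart_ymnm add0m.
  by move=> [h1 h2]; split=> [Qc|/h1[]//]; apply: h2; right.
have Nab i : (i <= k)%N -> U i a -> ~ V (k - i)%N b.
  by move=> ik Ui Vi; apply/P0/PE; exists i; rewrite add0m.
have NUk : ~ U k a.
  by move=> Uk; apply: (Nab k) => //; rewrite subnn (exponent0 filV).
have NVk : ~ V k b.
  move=> Vk; apply: (Nab 0%N) => //; last by rewrite subn0.
  by rewrite (exponent0 filU).
have [|d [dk Vd NVd]] := @jump_index (V^~ b) k _ NVk.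
  by rewrite (exponent0 filV).
have [|e [ek Ue NUe]] := @jump_index (U^~ a) k _ NUk.
  by rewrite (exponent0 filU).
have PUE : P = [set c | U (k - d)%N (c + a)%MM].
  apply/seteqP; split=> c /=.
    move=> /PE[i [ik Ui Vi]]; apply: (exponent_le filU) Ui.
    rewrite leqNgt; apply/negP=> lt_i; apply: NVd.
    by apply: (exponent_le filV) Vi; lia.
  by move=> Uc; apply/PE; exists (k - d)%N; rewrite leq_subr subKn // ltnW.
have QVE : Q = [set c | V (k - e)%N (c + b)%MM].
  apply/seteqP; split=> c /=.
    move=> /QE[i [ik Ui Vi]]; apply: (exponent_le filV) Vi.
    rewrite leq_sub2l // leqNgt; apply/negP=> lt_i; apply: NUe.
    exact: (exponent_le filU) Ui.
  by move=> Vc; apply/QE; exists e; rewrite ltnW.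
have Ukd : U (k - d).-1 a.
  by apply: (exponent_colon filU); rewrite ?subn_gt0 // colon_mideal -PUE.
have eE : (k - e)%N = d.+1.
  have le_e : (e < k - d)%N.
    rewrite ltnNge; apply/negP=> le_e; apply: (Nab (k - d)%N); rewrite ?leq_subr //.
      exact: (exponent_le filU) Ue.
    by rewrite subKn // ltnW.
  have : ((k - d).-1 <= e)%N.
    rewrite leqNgt; apply/negP=> lt_e; apply: NUe.
    exact: (exponent_le filU) Ukd.
  lia.
by exists d; split=> //; rewrite colon_mideal ?PUE ?QVE ?eE.
Qed.

Lemma local_vnumbers_attained k d p q : (d < k)%N ->
  Ass (mideal (U (k - d)%N)) p -> Ass (mideal (V d.+1)) q ->
  exists2 w, colon (mideal (sum_upset U V k)) 'X_[w] = sum_ext p q &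
    mdeg w = (local_vnumber (mideal (U (k - d)%N)) p
              + local_vnumber (mideal (V d.+1)) q)%N.
Proof.
move=> dk pA qA; have [[pP _] [qP _]] := (pA, qA).
have [[a aE <-] _] := local_vnumberP (@upU _) pA.
have [[b bE <-] _] := local_vnumberP (@upV _) qA.
exists (xmnm m a + ymnm n b)%MM; first by rewrite (@colon_glue k d) ?aE ?bE.
by rewrite mdeg_parts xpart_join ypart_join.
Qed.

Lemma local_vnumbers_bound k w P Q :
  is_prime (@mideal K n P) -> is_prime (@mideal K m Q) -> upset P -> upset Q ->
  colon (mideal (sum_upset U V k)) 'X_[w]
    = sum_ext (mideal P) (mideal Q) :> set {mpoly K[n + m]} ->
  exists d, [/\ (d < k)%N, Ass (@mideal K n (U (k - d)%N)) (mideal P),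
    Ass (@mideal K m (V d.+1)) (mideal Q) &
    (local_vnumber (@mideal K n (U (k - d)%N)) (mideal P)
      + local_vnumber (@mideal K m (V d.+1)) (mideal Q) <= mdeg w)%N].
Proof.
move=> prP prQ upP upQ wE.
have [d [dk aE bE]] := colon_split prP prQ upP upQ wE.
have pA : Ass (@mideal K n (U (k - d)%N)) (mideal P).
  by split=> //; exists 'X_[xpart w].
have qA : Ass (@mideal K m (V d.+1)) (mideal Q).
  by split=> //; exists 'X_[ypart w].
exists d; split=> //; rewrite mdeg_parts; apply: leq_add.
  by have [_] := local_vnumberP (@upU _) pA; apply; exists (xpart w).
by have [_] := local_vnumberP (@upV _) qA; apply; exists (ypart w).
Qed.

End Sum.

(** * The formulas for the v-numbers *)

Theorem theorem2p3 (K : fieldType) (n m : nat)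
    (I : set {mpoly K[n]}) (J : set {mpoly K[m]})
    (Ifil : nat -> set {mpoly K[n]}) (Jfil : nat -> set {mpoly K[m]})
    (Imon : is_monomial_ideal I) (Jmon : is_monomial_ideal J)
    (IfilP : graded_filtration_of I Ifil) (JfilP : graded_filtration_of J Jfil)
    (Ifil_mon : monomial_terms Ifil) (Jfil_mon : monomial_terms Jfil)
    (Ifil_colon : colon_condition Ifil) (Jfil_colon : colon_condition Jfil)
    (k : nat) (k_gt0 : (0 < k)%N) :
  (forall (p : set {mpoly K[n]}) (q : set {mpoly K[m]}),
     is_monomial_prime p -> is_monomial_prime q ->
     Ass (sum_filtration Ifil Jfil k) (sum_ext p q) ->
     is_min
       [set a | exists d : nat,
          [/\ (d < k)%N, Ass (Ifil (k - d)%N) p, Ass (Jfil d.+1) q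
            & a = (local_vnumber (Ifil (k - d)%N) p
                   + local_vnumber (Jfil d.+1) q)%N]]
       (local_vnumber (sum_filtration Ifil Jfil k) (sum_ext p q)))
  /\
  (sum_filtration Ifil Jfil k <> setT ->
   is_min
     [set a | exists (d : nat) (p : set {mpoly K[n]}) (q : set {mpoly K[m]}),
        [/\ (d < k)%N, Ass (Ifil (k - d)%N) p, Ass (Jfil d.+1) q,
            Ass (sum_filtration Ifil Jfil k) (sum_ext p q)
          & a = (local_vnumber (Ifil (k - d)%N) p
                 + local_vnumber (Jfil d.+1) q)%N]]
     (vnumber (sum_filtration Ifil Jfil k))).
Proof.
have [U filU ->] := filtration_exponents IfilP.1 Ifil_mon Ifil_colon.
have [V filV ->] := filtration_exponents JfilP.1 Jfil_mon Jfil_colon.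
have [upU upV] := (exponent_upset filU, exponent_upset filV).
have upS := upset_sum (k := k) upU upV.
rewrite sum_filtration_mideal //; split=> [p q pM qM sA|properS].
  have [[w wE wv] minv] := local_vnumberP upS sA.
  have le_sum d :
      (d < k)%N -> Ass (mideal (U (k - d)%N)) p -> Ass (mideal (V d.+1)) q ->
      (local_vnumber (mideal (sum_upset U V k)) (sum_ext p q)
        <= local_vnumber (mideal (U (k - d)%N)) p
           + local_vnumber (mideal (V d.+1)) q)%N.
    move=> dk pA qA; have [v vE <-] := local_vnumbers_attained filU filV dk pA qA.
    by apply: minv; exists v.
  split=> [|_ [d [dk pA qA ->]]]; last exact: le_sum.
  have [[P upP pE] [Q upQ qE]] := (monomial_primeP pM, monomial_primeP qM).
  have [[prP _] [prQ _]] := (pM, qM).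
  rewrite pE in prP wE; rewrite qE in prQ wE.
  have [d [dk pA qA le_w]] := local_vnumbers_bound filU filV prP prQ upP upQ wE.
  rewrite -pE in pA le_w; rewrite -qE in qA le_w.
  (* The parts of a monomial [w] of least degree have colons [p] and [q], so
     their degrees bound the two local v-numbers from above. *)
  exists d; split=> //; apply/eqP; rewrite eqn_leq le_sum //=.
  by rewrite -wv.
have [[w wP wv] minv] := vnumberP upS properS.
have le_sum d (p : set {mpoly K[n]}) (q : set {mpoly K[m]}) :
    (d < k)%N -> Ass (mideal (U (k - d)%N)) p -> Ass (mideal (V d.+1)) q ->
    Ass (mideal (sum_upset U V k)) (sum_ext p q) ->
    (vnumber (@mideal K _ (sum_upset U V k))
      <= local_vnumber (mideal (U (k - d)%N)) p
         + local_vnumber (mideal (V d.+1)) q)%N.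
  move=> dk pA qA [pqP _].
  have [v vE <-] := local_vnumbers_attained filU filV dk pA qA.
  by apply: minv; exists v; rewrite ?vE.
split=> [|_ [d [p [q [dk pA qA sA ->]]]]]; last exact: le_sum.
have sA : Ass (mideal (sum_upset U V k))
             (colon (@mideal K _ (sum_upset U V k)) 'X_[w]).
  by split=> //; exists 'X_[w].
have := wP; rewrite colon_mideal => wP'.
have [P [Q [upP upQ prP prQ WE]]] := prime_split (upset_colon upS) wP'.
have wE : colon (mideal (sum_upset U V k)) 'X_[w]
    = sum_ext (mideal P) (mideal Q) :> set {mpoly K[n + m]}.
  by rewrite colon_mideal WE sum_ext_mideal.
have [d [dk pA qA le_w]] := local_vnumbers_bound filU filV prP prQ upP upQ wE.
rewrite wE in sA.
exists d, (mideal P), (mideal Q); split=> //.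
by apply/eqP; rewrite eqn_leq le_sum //= -wv.
Qed.
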